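(* For every $n\ge1$ there exists an involution $\Psi$ on $S_n$ such that for all $\pi\in S_n$ the following three equalities hold simultaneously: $$(21,\{(1,0),(2,0),(2,2)\})(\pi)=(21,\{(1,0),(2,0),(2,1)\})(\Psi(\pi)),$$ $$(21,\{(1,0),(1,1),(2,0),(2,2)\})(\pi)=(21,\{(1,0),(1,2),(2,0),(2,1)\})(\Psi(\pi)),$$ $$(21,\{(1,0),(1,1),(1,2),(2,0),(2,2)\})(\pi)=(21,\{(1,0),(1,1),(1,2),(2,0),(2,1)\})(\Psi(\pi)).$$
   Context: $S_n$ is the set of permutations of $\{1,\dots,n\}$ in one-line notation. A mesh pattern of length $k$ is a pair $(\tau,R)$ with $\tau\in S_k$ and $R\subseteq\{0,\dots,k\}\times\{0,\dots,k\}$ (the set of shaded boxes; $(i,j)$ is the box in column $i$, row $j$, with lower left corner $(i,j)$). An occurrence of $(\tau,R)$ in $\pi\in S_n$ is a choice of positions $a_1<\cdots<a_k$ such that $\pi(a_1)\cdots\pi(a_k)$ is order-isomorphic to $\tau$ and, writing $v_1<\cdots<v_k$ for the values $\pi(a_1),\dots,\pi(a_k)$ sorted increasingly and $a_0=v_0=0$, $a_{k+1}=v_{k+1}=n+1$, for every $(i,j)\in R$ there is no position $c$ with $a_i<c<a_{i+1}$ and $v_j<\pi(c)<v_{j+1}$. For a mesh pattern $p$, $p(\pi)$ denotes the number of occurrences of $p$ in $\pi$. An involution is a map equal to its own inverse. *)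

(* Defs.v *)
From mathcomp Require Import all_boot all_fingroup.

Set Implicit Arguments.
Unset Strict Implicit.
Unset Printing Implicit Defensive.

(* A permutation in 'S_n acts on {0, .., n-1}; positions and values are shifted
   by one below, so that 0 and n+1 are the outer grid lines. *)

Definition mesh_pattern (k : nat) : Type :=
  ('S_k * {set 'I_k.+1 * 'I_k.+1})%type.

Section Occurrences.

Variables (k n : nat).
Implicit Types (p : mesh_pattern k) (pi : 'S_n) (a : k.-tuple 'I_n).

(* For s = [:: s_1; ...; s_k], this is s_i with s_0 = 0 and s_(k+1) = n+1. *)
Definition grid_line (s : seq nat) (i : nat) : nat := nth n.+1 (0 :: s) i.

Definition positions a : seq nat := [seq (val i).+1 | i <- a].

Definition sorted_values pi a : seq nat :=
  sort leq [seq (val (pi i)).+1 | i <- a].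

Definition in_box pi a (i j : nat) (c : 'I_n) : bool :=
  (grid_line (positions a) i < c.+1 < grid_line (positions a) i.+1) &&
  (grid_line (sorted_values pi a) j < (pi c).+1
     < grid_line (sorted_values pi a) j.+1).

Definition order_isomorphic (tau : 'S_k) pi a : bool :=
  [forall x : 'I_k, forall y : 'I_k,
    (pi (tnth a x) < pi (tnth a y)) == (tau x < tau y)].

Definition occurrence p pi a : bool :=
  [&& sorted ltn (positions a),
      order_isomorphic p.1 pi a
    & [forall b in p.2, ~~ [exists c : 'I_n, in_box pi a b.1 b.2 c]]].

Definition occurrences p pi : nat := #|[set a | occurrence p pi a]|.

End Occurrences.

(* Pairs in s with a component larger than k are ignored. *)
Definition boxes (k : nat) (s : seq (nat * nat)) : {set 'I_k.+1 * 'I_k.+1} :=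
  [set b | (val b.1, val b.2) \in s].

(* The transposition of the two points of 'I_2 is 21 in one-line notation. *)
Definition mesh21 (s : seq (nat * nat)) : mesh_pattern 2 :=
  (tperm ord0 ord_max, boxes 2 s).

(* Main.v *)
Require Import Defs.
From mathcomp Require Import all_boot all_fingroup.
From mathcomp Require Import zify.

(* In an occurrence at positions p < q of any of the patterns, the shading of
   (1,0) and (2,0) says that q carries the smallest entry to the right of p, and
   that it is the first right-to-left minimum after p. Let l(p) be the Lehmer
   code, the number of smaller entries to the right of p, so that l(p) = 0
   exactly at right-to-left minima. The involution sends each nonzero l(p) to
   N(p) + 1 - l(p), where N(p) is the number of positions after p, and keeps the
   zeros. This preserves the pairs (p, q), reverses the comparisons between
   entries at positions in [p, q), and exchanges "above p" with "below p" in the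
   count of entries to the right of q. So even the set of positions of the
   occurrences is preserved. *)

Set Implicit Arguments.
Unset Strict Implicit.
Unset Printing Implicit Defensive.

(** * Ranks among the later entries and the Lehmer code *)

Section Rank.

Variable n : nat.
Implicit Types (pi sg : 'S_n) (p q t x : 'I_n).

(** The bound [t] is a natural number, not a position, so that [t = n] (no entries left) is
    allowed. *)
Definition rank pi (t : nat) p : nat :=
  #|[set q : 'I_n | (t <= q) && (pi q < pi p)]|.

Definition code pi p : nat := rank pi p p.

Lemma card_ord_geq (t : nat) : #|[set q : 'I_n | t <= q]| = n - t.
Proof.
rewrite -sum1dep_card -(big_geq_mkord t n xpredT (fun=> 1)).
by rewrite sum_nat_const_nat muln1.
Qed.

Lemma rank_rec pi t x : rank pi t x = (pi t < pi x) + rank pi t.+1 x.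
Proof.
rewrite /rank (cardsD1 t) inE leqnn; congr (_ + #|pred_of_set _|).
apply/setP=> c; rewrite !inE andbA; congr (_ && _).
by rewrite ltn_neqAle eq_sym.
Qed.

Lemma codeE pi p : code pi p = rank pi p.+1 p.
Proof. by rewrite /code rank_rec ltnn. Qed.

Lemma rank_le pi (t : nat) p : rank pi t p <= n - t.
Proof.
by rewrite -card_ord_geq subset_leq_card //; apply/subsetP=> c; rewrite !inE => /andP[].
Qed.

Lemma code_lt pi p : code pi p < n - p.
Proof. rewrite codeE; have := rank_le pi p.+1 p; have := ltn_ord p; lia. Qed.

Lemma rank0 pi p : rank pi 0 p = pi p.
Proof.
have -> : rank pi 0 p = #|pi @^-1: [set y : 'I_n | y < pi p]|.
  by apply: eq_card => c; rewrite !inE.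
rewrite card_preimset; last exact: perm_inj.
have := cardsC [set y : 'I_n | y < pi p].
have -> : ~: [set y : 'I_n | y < pi p] = [set y : 'I_n | pi p <= y].
  by apply/setP=> y; rewrite !inE -leqNgt.
by rewrite card_ord_geq card_ord => /(canRL (addnK _)) ->; rewrite subKn // ltnW.
Qed.

(* Inserting the entry at position t in front of the entries after t: its place
   among them is determined by its code alone. *)
Lemma lt_code_rank pi t x :
  t < x -> (pi t < pi x) = (code pi t <= rank pi t.+1 x).
Proof.
move=> tx; rewrite codeE; case: ltngtP => [lt|gt|/val_inj/perm_inj eq].
- apply/esym/subset_leq_card/subsetP=> c; rewrite !inE => /andP[-> /=].
  by move/ltn_trans; apply.
- apply/esym/negbTE; rewrite -ltnNge; apply: proper_card; apply/properP; split.
    apply/subsetP=> c; rewrite !inE => /andP[-> /=].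
    by move/ltn_trans; apply.
  by exists x; rewrite !inE tx ?ltnn.
- by rewrite eq ltnn in tx.
Qed.

(** Lowering [t] from [p] to 0 adds one comparison at a time, and by [lt_code_rank] each is settled
    by a code and the rank already known. *)
Lemma eq_rank_code pi sg : code pi =1 code sg ->
  forall p, rank pi 0 p = rank sg 0 p.
Proof.
move=> eq_code.
have eq_after (d t : nat) p : p.+1 - t <= d -> t <= p ->
    rank pi t p = rank sg t p.
  elim: d t p => [|d IHd] t p; first lia.
  move=> le_d; rewrite leq_eqVlt => /predU1P[->|tp]; first exact: eq_code.
  have tn : t < n by exact: ltn_trans tp (ltn_ord p).
  rewrite !(rank_rec _ (Ordinal tn)) !lt_code_rank // eq_code IHd //=; lia.
by move=> p; apply: (eq_after p.+1).
Qed.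

Definition lehmer pi : {dffun forall p : 'I_n, 'I_(n - p)} :=
  [ffun p => Ordinal (code_lt pi p)].

Lemma lehmerE pi p : lehmer pi p = code pi p :> nat.
Proof. by rewrite ffunE. Qed.

Lemma lehmer_inj : injective lehmer.
Proof.
move=> pi sg eq_l; apply/permP=> p; apply: val_inj; rewrite /= -!rank0.
by apply: eq_rank_code => x; rewrite -!lehmerE eq_l.
Qed.

Lemma lehmer_bij : bijective lehmer.
Proof.
apply: inj_card_bij; first exact: lehmer_inj.
(* Both sides have n! elements: the product of the [n - i] is the falling factorial [n ^_ n]. *)
rewrite card_dep_ffun card_Sn -ffactnn ffact_prod foldrE big_map big_enum /=.
by apply: eq_leq; apply: eq_bigr => i _; rewrite card_ord.
Qed.

(** * Complementing the nonzero codes *)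

Definition flip_val (m l : nat) : nat := if l == 0 then 0 else m - l.

Lemma flip_subproof m (l : 'I_m) : flip_val m l < m.
Proof. by rewrite /flip_val; case: eqP; have := ltn_ord l; lia. Qed.

Definition flip m (l : 'I_m) : 'I_m := Ordinal (flip_subproof l).

Lemma flipK m : involutive (@flip m).
Proof.
by move=> l; apply: val_inj; rewrite /= /flip_val; have := ltn_ord l; do 2?case: eqP; lia.
Qed.

Definition flipf (f : {dffun forall p : 'I_n, 'I_(n - p)}) :
  {dffun forall p : 'I_n, 'I_(n - p)} := [ffun p => flip (f p)].

Lemma flipfK : involutive flipf.
Proof. by move=> f; apply/ffunP=> p; rewrite !ffunE flipK. Qed.

(** Here [n - p] is one more than the number of positions after [p]. As a symmetric relation, it
    lets every later transfer be used in both directions. *)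
Definition twins pi sg : Prop := forall p, code sg p = flip_val (n - p) (code pi p).

Lemma twins_sym pi sg : twins pi sg -> twins sg pi.
Proof.
move=> tw p; rewrite tw /flip_val; have := code_lt pi p.
case: (code pi p =P 0) => [-> //|? ?]; case: eqP; first lia. by rewrite subKn 1?ltnW.
Qed.

Lemma twins_involution :
  exists Psi : 'S_n -> 'S_n, involutive Psi /\ forall pi, twins pi (Psi pi).
Proof.
case: lehmer_bij => g lK gK; exists (fun pi => g (flipf (lehmer pi))).
split=> [pi | pi p]; first by rewrite gK flipfK lK.
by rewrite -lehmerE gK ffunE /= lehmerE.
Qed.

Lemma twins_code0 pi sg p : twins pi sg -> (code sg p == 0) = (code pi p == 0).
Proof. by move=> ->; rewrite /flip_val; have := code_lt pi p; case: (code pi p =P 0); lia. Qed.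

(* Prepending a first entry never disturbs the complementarity of the ranks: it
   lies below x in exactly one of the two permutations. *)
Lemma twins_rank pi sg t x : twins pi sg -> t <= x ->
    (forall c : 'I_n, t <= c <= x -> 0 < code pi c) ->
  rank pi t x + rank sg t x = n - t.
Proof.
move=> tw; move d: (x - t) => e; elim: e t d => [|e IHe] t d tx pos.
  have -> : t = x by apply: val_inj; move: d tx => /=; lia.
  have := pos x; rewrite tx leqnn => /(_ isT).
  have := tw x; rewrite /code /flip_val => ->; have := code_lt pi x.
  by rewrite /code; case: eqP; lia.
have tx' : t < x by lia.
have t1n : t.+1 < n by have := ltn_ord x; lia.
have := IHe (Ordinal t1n); rewrite /= => /(_ _ tx') -IH.
have {}IH : rank pi t.+1 x + rank sg t.+1 x = n - t.+1.
  by apply: IH => [|c /andP[tc cx]]; [lia | apply: pos; rewrite ltnW].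
have := pos t; rewrite tx leqnn => /(_ isT) post.
rewrite !rank_rec !lt_code_rank // tw /flip_val.
have := code_lt pi t; case: (code pi t =P 0); lia.
Qed.

(** Subtracting [twins_rank] at [t.+1] from [twins_rank] at [t] leaves 1, so exactly one of the two
    comparisons holds. *)
Lemma twins_reverse pi sg t x : twins pi sg -> t < x ->
    (forall c : 'I_n, t <= c <= x -> 0 < code pi c) ->
  (sg t < sg x) = (pi x < pi t).
Proof.
move=> tw tx pos; have := twins_rank tw (ltnW tx) pos.
have t1n : t.+1 < n by have := ltn_ord x; lia.
have : rank pi t.+1 x + rank sg t.+1 x = n - t.+1.
  apply: (@twins_rank _ _ (Ordinal t1n)) => // c /andP[tc cx].
  by apply: pos; rewrite ltnW.
rewrite !rank_rec; have : pi t != pi x :> nat.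
  by apply: contraTneq tx => /val_inj/perm_inj ->; rewrite ltnn.
have := ltn_ord t; lia.
Qed.

(** * Pairs of a position and the first right-to-left minimum after it *)

Definition next_min pi p q : bool :=
  (p < q) && [forall c : 'I_n, (p <= c) ==> (c != q) ==> (pi q < pi c)].

Lemma next_minP pi p q :
  reflect [/\ p < q, code pi q = 0 & forall c : 'I_n, p <= c < q -> 0 < code pi c]
          (next_min pi p q).
Proof.
apply: (iffP andP) => [[pq /forallP minq]|[pq q0 pos]]; split=> //.
- apply: eq_card0 => c; rewrite !inE; apply/negbTE/negP=> /andP[qc lt].
  have /implyP/(_ (leq_trans (ltnW pq) qc))/implyP := minq c.
  case: (eqVneq c q) lt => [->|_ lt /(_ isT)]; first by rewrite ltnn.
  by rewrite ltnNge ltnW.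
- move=> c /andP[pc cq]; rewrite card_gt0; apply/set0Pn; exists q.
  rewrite inE (ltnW cq) /=; have /implyP/(_ pc)/implyP := minq c; apply.
  by apply: contraTneq cq => ->; rewrite ltnn.
(* The position [m] of the least entry from [p] on has code 0, so it is not before [q]; were it
   after [q], the code of [q] would be positive. *)
case: (@arg_minnP _ p (fun c : 'I_n => p <= c) (fun c => val (pi c)) (leqnn p)) => m pm minm.
have m0 : code pi m = 0.
  apply: eq_card0 => c; rewrite !inE; apply/negbTE/negP=> /andP[mc].
  by rewrite ltnNge minm // (leq_trans pm).
have qm : q <= m.
  by rewrite leqNgt; apply/negP=> mq; have := pos m; rewrite pm mq m0 => /(_ isT).
have eqm : m = q.
  apply/eqP/negPn/negP=> mq; have : m \in [set c : 'I_n | (q <= c) && (pi c < pi q)].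
    rewrite inE qm ltn_neqAle (minm q (ltnW pq)) andbT.
    by rewrite (inj_eq val_inj) (inj_eq perm_inj).
  by rewrite (eqP (etrans (esym (cards_eq0 _)) (introT eqP q0))) inE.
apply/forallP=> c; apply/implyP=> pc; apply/implyP=> cq.
rewrite -eqm ltn_neqAle minm // andbT eqm (inj_eq val_inj) (inj_eq perm_inj).
by rewrite eq_sym.
Qed.

Lemma twins_next_min pi sg p q :
  twins pi sg -> next_min pi p q -> next_min sg p q.
Proof.
move=> tw /next_minP[pq q0 pos]; apply/next_minP; split=> //.
  by apply/eqP; rewrite (twins_code0 _ tw) q0.
by move=> c /pos; rewrite !lt0n (twins_code0 _ tw).
Qed.

(** The two ranks of [p] start at [p.+1] with a sum one above the number of remaining positions.
    Each position before [q] lowers both by one; [q], lying below [p] in both permutations, lowers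
    the sum by two and removes the excess. *)
Lemma twins_rank_after pi sg p q : twins pi sg -> next_min pi p q ->
  rank pi q.+1 p + rank sg q.+1 p = n - q.+1.
Proof.
move=> tw nm; have [pq q0 pos] := next_minP _ _ _ nm.
have base s : next_min s p q -> s q < s p.
  move=> /andP[_ /forallP/(_ p)]; rewrite leqnn /= => /implyP; apply.
  by apply: contraTneq pq => ->; rewrite ltnn.
have sum (d : nat) : p + d.+1 <= q ->
    rank pi (p + d.+1) p + rank sg (p + d.+1) p = (n - (p + d.+1)).+1.
  elim: d => [|d IHd] le_q.
    rewrite addn1 -!codeE twins_rank //; first by have := ltn_ord p; lia.
    by move=> c /andP[pc cp]; apply: pos; lia.
  have tn : p + d.+1 < n by have := ltn_ord q; lia.
  pose t := Ordinal tn; have pt : p < t by rewrite /=; lia.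
  have := IHd; rewrite -[p + d.+1]/(val t) !rank_rec -(addnS p) addnS => IH.
  have := @twins_reverse pi sg p t tw pt.
  have : pi t != pi p :> nat.
    by apply: contraTneq pt => /val_inj/perm_inj ->; rewrite ltnn.
  have : sg t != sg p :> nat.
    by apply: contraTneq pt => /val_inj/perm_inj ->; rewrite ltnn.
  have : forall c : 'I_n, p <= c <= t -> 0 < code pi c.
    by move=> c /andP[pc /= ct]; apply: pos; lia.
  move=> h ? ? /(_ h); move: IH => /=; lia.
have := sum (q - p).-1; rewrite prednK ?subn_gt0 // subnKC ?(ltnW pq) //.
move=> /(_ (leqnn _)); rewrite !rank_rec !base // ?(twins_next_min tw nm) //.
have := ltn_ord q; lia.
Qed.

End Rank.

(** * Occurrences of length two as conditions on a pair of positions *)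

(* Column i <= 2, row j <= 2 of the grid cut out by two lines u < v; larger
   indices give the empty zone, matching the boxes that [boxes 2] ignores. *)
Definition zone (u v i x : nat) : bool :=
  nth false [:: x < u; u < x < v; v < x] i.

Definition avoids n (pi : 'S_n) (p q : 'I_n) (b : nat * nat) : bool :=
  [forall c : 'I_n, ~~ (zone p q b.1 c && zone (pi q) (pi p) b.2 (pi c))].

Lemma zone_le2 u v i x : zone u v i x -> i <= 2.
Proof. by case: i => [|[|[|i]]]; rewrite // /zone /= nth_nil. Qed.

Lemma grid_line_zone n (u v i x : nat) : x < n -> i <= 2 ->
  (grid_line n [:: u.+1; v.+1] i < x.+1 < grid_line n [:: u.+1; v.+1] i.+1)
    = zone u v i x.
Proof.
move=> xn; rewrite /grid_line /zone; case: i => [|[|[|i]]] //= _.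
by rewrite !ltnS xn andbT.
Qed.

Lemma order_isomorphic21 n (pi : 'S_n) (p q : 'I_n) :
  order_isomorphic (tperm ord0 ord_max) pi [tuple p; q] = (pi q < pi p).
Proof.
have two (z : 'I_2) : z = ord0 \/ z = ord_max.
  by case: z => [[|[|z]] lt]; [left|right|]; try exact: val_inj.
apply/forallP/idP => [/(_ ord_max)/forallP/(_ ord0)/eqP|lt x].
  by rewrite tpermL tpermR !(tnth_nth p).
apply/forallP=> y; rewrite !(tnth_nth p).
case: (two x) => ->; case: (two y) => ->; rewrite ?tpermL ?tpermR /= ?ltnn //.
  by rewrite ltnNge ltnW.
by rewrite lt.
Qed.

Lemma occurrence_mesh21 n (pi : 'S_n) (s : seq (nat * nat)) (a : 2.-tuple 'I_n) :
  let p := tnth a ord0 in let q := tnth a ord_max in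
  occurrence (mesh21 s) pi a
    = [&& p < q, pi q < pi p & all (avoids pi p q) s].
Proof.
case/tupleP: a => p a; case/tupleP: a => q a; rewrite (tuple0 a) {a} /=.
have -> : tnth [tuple p; q] ord0 = p by [].
have -> : tnth [tuple p; q] ord_max = q by rewrite (tnth_nth p).
rewrite /occurrence order_isomorphic21 {1}/positions /= andbT ltnS.
case: (ltnP p q) => //= pq; case: (ltnP (pi q) (pi p)) => //= lt.
have sv : sorted_values pi [tuple p; q] = [:: (pi q).+1; (pi p).+1].
  by rewrite /sorted_values /sort /= ltnS leqNgt lt.
have box (c : 'I_n) i j : i <= 2 -> j <= 2 -> in_box pi [tuple p; q] i j c
    = zone p q i c && zone (pi q) (pi p) j (pi c).
  by move=> i2 j2; rewrite /in_box sv !grid_line_zone.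
apply/forall_inP/allP => [H [i j] ijs|H [i j]].
  apply/forallP=> c; apply/negP=> /= /andP[zi zj].
  (* A nonempty zone has indices at most 2, so [inord] recovers the genuine box. *)
  have [i2 j2] := (zone_le2 zi, zone_le2 zj).
  have := H (inord i, inord j); rewrite inE /= !inordK // => /(_ ijs)/negP; apply.
  by apply/existsP; exists c; rewrite box // zi.
rewrite inE /= => /H/forallP/= avo; apply/negP=> /existsP[c].
by rewrite box -1?ltnS //; apply/negP.
Qed.

(** * Empty boxes in terms of ranks, and their exchange between twins *)

Section Avoidance.

Variable n : nat.
Implicit Types (pi sg : 'S_n) (p q : 'I_n).

Lemma neq_perm pi p q : p != q -> pi p != pi q :> nat.
Proof. by apply: contra_neq => /val_inj/perm_inj. Qed.

Lemma next_minE pi p q : next_min pi p q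
  = [&& p < q, pi q < pi p, avoids pi p q (1, 0) & avoids pi p q (2, 0)].
Proof.
rewrite /next_min; case: (ltnP p q) => //= pq.
apply/forallP/and3P => [minq|[lt /forallP av1 /forallP av2] c].
  have {}minq (c : 'I_n) : p <= c -> c != q :> nat -> pi q < pi c.
    by move=> pc cq; have /implyP/(_ pc)/implyP/(_ cq) := minq c.
  split; first by rewrite minq // ltn_eqF.
    apply/forallP=> c; apply/negP=> /andP[/andP[pc cq]].
    by rewrite /zone /= ltnNge ltnW // minq ?(ltnW pc) // ltn_eqF.
  apply/forallP=> c; apply/negP=> /andP[/= qc].
  rewrite /zone /= ltnNge ltnW // minq ?gtn_eqF //.
  exact: ltnW (ltn_trans pq qc).
apply/implyP=> pc; apply/implyP=> cq; have := av1 c; have := av2 c.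
move: cq (neq_perm pi cq); rewrite /zone /= -(inj_eq val_inj) /=.
have [->|] := eqVneq c p; first by rewrite lt.
rewrite -(inj_eq val_inj) /=; lia.
Qed.

Lemma avoids_above_rank pi p q : p < q ->
  avoids pi p q (2, 2) = (rank pi q.+1 p == n - q.+1).
Proof.
move=> pq; have sub : [set c : 'I_n | (q.+1 <= c) && (pi c < pi p)]
    \subset [set c : 'I_n | q.+1 <= c].
  by apply/subsetP=> c; rewrite !inE => /andP[].
rewrite -card_ord_geq /rank (subset_leqif_cards sub).2 eqEsubset sub /=.
apply/forallP/subsetP=> [H c|H c].
  rewrite !inE => qc; have := H c; rewrite /zone /= qc /= -leqNgt => le.
  rewrite ltn_neqAle le andbT neq_perm //.
  by rewrite -(inj_eq val_inj) gtn_eqF // (ltn_trans pq).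
apply/negP; rewrite /zone /= => /andP[qc]; rewrite ltnNge ltnW //.
by have := H c; rewrite !inE => /(_ qc)/andP[].
Qed.

(** Nothing after [q] lies below [pi q], so every later entry below [pi p] falls in box (2, 1). *)
Lemma avoids_between_rank pi p q : next_min pi p q ->
  avoids pi p q (2, 1) = (rank pi q.+1 p == 0).
Proof.
rewrite next_minE => /and4P[_ _ _ /forallP above].
rewrite cards_eq0 -subset0; apply/forallP/subsetP=> [H c|H c].
  rewrite !inE => /andP[qc cp]; have := H c; have := above c.
  rewrite /zone /= qc cp /= andbT -!leqNgt => le.
  rewrite leq_eqVlt ltnNge le orbF => /eqP/val_inj/perm_inj eq.
  by rewrite eq ltnn in qc.
apply/negP; rewrite /zone /= => /and3P[qc _ cp].
by have := H c; rewrite !inE qc cp => /(_ isT).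
Qed.

Lemma twins_avoids pi sg p q : twins pi sg -> next_min pi p q ->
  avoids pi p q (2, 2) = avoids sg p q (2, 1) /\
  avoids pi p q (1, 1) = avoids sg p q (1, 2).
Proof.
move=> tw nm; have [pq _ pos] := next_minP _ _ _ nm; split.
  rewrite avoids_above_rank // avoids_between_rank ?(twins_next_min tw) //.
  by have := twins_rank_after tw nm; lia.
apply: eq_forallb => c; congr (~~ _); rewrite /zone /=.
case: (boolP (p < c < q)) => //= /andP[pc cq].
rewrite (twins_reverse tw pc) => [|d /andP[pd dc]]; last first.
  by apply: pos; rewrite pd (leq_ltn_trans dc).
move: nm => /andP[_ /forallP/(_ c)]; rewrite (ltnW pc) -(inj_eq val_inj) ltn_eqF //=.
by move->.
Qed.

Lemma twins_next_minE pi sg p q : twins pi sg -> next_min pi p q = next_min sg p q.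
Proof.
by move=> tw; apply/idP/idP; apply: twins_next_min => //; apply: twins_sym.
Qed.

End Avoidance.

Theorem theorem1p9 (n : nat) (hn : 1 <= n) :
  exists Psi : 'S_n -> 'S_n,
    involutive Psi /\
    forall pi : 'S_n,
      [/\ occurrences (mesh21 [:: (1, 0); (2, 0); (2, 2)]) pi
            = occurrences (mesh21 [:: (1, 0); (2, 0); (2, 1)]) (Psi pi),
          occurrences (mesh21 [:: (1, 0); (1, 1); (2, 0); (2, 2)]) pi
            = occurrences (mesh21 [:: (1, 0); (1, 2); (2, 0); (2, 1)]) (Psi pi)
        & occurrences (mesh21 [:: (1, 0); (1, 1); (1, 2); (2, 0); (2, 2)]) pi
            = occurrences (mesh21 [:: (1, 0); (1, 1); (1, 2); (2, 0); (2, 1)])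
                (Psi pi)].
Proof.
have [Psi [PsiK tw]] := twins_involution n.
exists Psi; split=> // pi; have twp := tw pi; have twi := twins_sym twp.
(* The two sets of occurrences agree tuple by tuple. *)
split; apply: eq_card => a; rewrite !inE !occurrence_mesh21 /=.
all: set p := tnth a _; set q := tnth a _.
all: have eqN := twins_next_minE p q twp.
all: have := next_minE pi p q; have := next_minE (Psi pi) p q.
all: case: (boolP (next_min pi p q)) eqN => [N|_] <-; last lia.
all: have [? ?] := twins_avoids twp N.
(* The third equality also needs box (1, 2) of [pi] matched with box (1, 1) of [Psi pi], obtained by
   swapping the twins. *)
all: have [_ ?] := twins_avoids twi (twins_next_min twp N).
all: lia.
Qed.
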